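(* Let $n\ge 2$ be an integer, let $a<b$, and let $u\in C^{n}((a,b))\cap C^{n-1}([a,b))$ be a real-valued function satisfying $$u^{(n)}(x)+a_{n-1}(x)u^{(n-1)}(x)+\cdots+a_1(x)u'(x)+a_0(x)u(x)\le 0\quad\text{for } x\in(a,b),$$ where $a_{n-1},\dots,a_1,a_0$ are real-valued functions in $C([a,b))$. Suppose $$u(a)=u'(a)=\cdots=u^{(n-2)}(a)=0,$$ and that there exists a sequence $\{x_i\}$ such that $a<x_i<b$, $x_i\to a$, and $u(x_i)>0$ for all $i$. Then $u^{(n-1)}(a)>0$. Furthermore, $u>0$ in a neighborhood of $a$, i.e. there is $\delta>0$ such that $u(x)>0$ for all $x\in(a,a+\delta)$. When $n=2$, the same conclusions hold if, instead of $a_1,a_0\in C([a,b))$, one only assumes that $a_1$ and $a_0$ are bounded functions.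
   Context: $C^{n-1}([a,b))$ denotes functions that are $n-1$ times continuously differentiable up to the endpoint $a$, with derivatives at $a$ understood as one-sided derivatives. $C([a,b))$ denotes the continuous functions on $[a,b)$. *)

(* Defs.v *)
From HB Require Import structures.
From mathcomp Require Import all_boot all_order all_algebra.
From mathcomp Require Import all_classical all_reals all_analysis.

Set Implicit Arguments.
Unset Strict Implicit.
Unset Printing Implicit Defensive.

Import Order.TTheory GRing.Theory Num.Theory.
Import numFieldNormedType.Exports.

Local Open Scope classical_set_scope.
Local Open Scope ring_scope.

(* Same difference quotient as in [derivable] and [derive1], but restricted to
   the increments [h] such that [h + x] stays in [D]: this is the usual two-sided
   notion at interior points of [D] (see [derive1n_on_interior]) and the right
   one-sided notion at the left endpoint of [a, b) (see [derive1_on_left]). *)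
Definition dquot_on (R : realType) (D : set R) (f : R -> R) (x : R) :
    set_system R :=
  (h^-1 *: (f (h + x) - f x) : R) @[h --> within [set h | D (h + x)] 0^'].

Definition derivable_on (R : realType) (D : set R) (f : R -> R) (x : R) : Prop :=
  cvg (dquot_on D f x).

Definition derive1_on (R : realType) (D : set R) (f : R -> R) (x : R) : R :=
  lim (dquot_on D f x).

Definition derive1n_on (R : realType) (D : set R) (k : nat) (f : R -> R) :
    R -> R :=
  iter k (derive1_on D) f.

Definition Ck_on (R : realType) (D : set R) (k : nat) (f : R -> R) : Prop :=
  (forall j : nat, (j < k)%N -> forall x, D x ->
     derivable_on D (derive1n_on D j f) x) /\
  {within D, continuous (derive1n_on D k f)}.

Lemma dquot_on_interior (R : realType) (D : set R) (f : R -> R) (x : R) :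
  D° x -> dquot_on D f x = (h^-1 *: (f (h + x) - f x) : R) @[h --> 0^'].
Proof.
move=> Dx; rewrite /dquot_on.
suff -> : within [set h | D (h + x)] 0^' = 0^' by [].
have cx : (h + x) @[h --> (0 : R)] --> x.
  have /cvgD : h @[h --> (0 : R)] --> (0 : R) by exact: cvg_id.
  by move=> /(_ (cst x) x (cvg_cst x)); rewrite add0r.
have D0 : \forall h \near (0 : R)^', D (h + x).
  by apply: nbhs_dnbhs; exact: (cx D).
rewrite eqEsubset; split => A /=; rewrite /within /= => HA.
  by apply: filterS2 D0 HA => h Dh; apply.
by apply: filterS HA => h.
Qed.

Lemma derivable_on_interior (R : realType) (D : set R) (f : R -> R) (x : R) :
  D° x -> derivable_on D f x <-> derivable f x 1.
Proof.
move=> Dx; rewrite /derivable_on (dquot_on_interior _ Dx) /derivable.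
suff -> : (fun h : R => h^-1 *: (f (h + x) - f x)) =
          (fun h : R => h^-1 *: (f (h *: 1 + x) - f x)) by [].
by apply/funext => h; rewrite [h *: 1]mulr1.
Qed.

Lemma derive1n_on_interior (R : realType) (D : set R) (k : nat) (f : R -> R)
  (x : R) : D° x -> derive1n_on D k f x = derive1n k f x.
Proof.
elim: k x => [//|k IH] x Dx.
rewrite derive1nS /derive1n_on iterS -/(derive1n_on D k f).
rewrite /derive1_on (dquot_on_interior _ Dx) /derive1.
suff eqk : \forall h \near (0 : R)^',
    h^-1 *: (derive1n_on D k f (h + x) - derive1n_on D k f x) =
    h^-1 *: (derive1n k f (h + x) - derive1n k f x).
  congr (lim _); rewrite eqEsubset; split => A /= HA.
    by apply: filterS2 eqk HA => h /= ->.
  by apply: filterS2 eqk HA => h /= <-.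
have cx : (h + x) @[h --> (0 : R)] --> x.
  have /cvgD : h @[h --> (0 : R)] --> (0 : R) by exact: cvg_id.
  by move=> /(_ (cst x) x (cvg_cst x)); rewrite add0r.
have D0 : \forall h \near (0 : R)^', D° (h + x).
  apply: nbhs_dnbhs; apply: (cx D°).
  by apply: open_nbhs_nbhs; split => //; exact: open_interior.
by apply: filterS D0 => h Dh; rewrite !IH.
Qed.

Lemma derive1_on_left (R : realType) (a b : R) (f : R -> R) : a < b ->
  derive1_on `[a, b[ f a = lim ((h^-1 *: (f (h + a) - f a) : R) @[h --> 0^'+]).
Proof.
move=> ab; rewrite /derive1_on /dquot_on.
suff -> : within [set h | `[a, b[%classic (h + a)] (0 : R)^' = 0^'+ by [].
have hb : \forall h \near (0 : R), h < b - a.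
  by apply: lt_nbhsl; rewrite subr_gt0.
rewrite eqEsubset /at_right /dnbhs; split => A /=; rewrite /within /= => HA.
  apply: filterS2 hb HA => h hba HA h0; apply: HA; first by rewrite gt_eqF.
  by rewrite in_itv /= lerDr (ltW h0) -ltrBrDr.
apply: filterS HA => h HA h0; rewrite in_itv /= lerDr => /andP[h0' _].
by apply: HA; rewrite lt_neqAle eq_sym h0.
Qed.

(* Main.v *)
Require Import Defs.
From mathcomp Require Import all_boot all_order all_algebra.
From mathcomp Require Import all_classical all_reals all_analysis.
From mathcomp Require Import zify lra.
Import Order.TTheory GRing.Theory Num.Theory.
Import numFieldNormedType.Exports.
Local Open Scope classical_set_scope.
Local Open Scope ring_scope.

(** Write [m] for [n - 1] and [w] for the derivative of order [m] of [u]. Each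
    of the two regularity assumptions bounds the coefficients on some interval
    to the right of [a]; the argument runs on such an interval
    ([sign_near_endpoint]).

    The first idea is that the vanishing initial data carry information down
    from [w] to [u]: by the mean value theorem, each derivative at [y] is
    [y - a] times the next one at an intermediate point, so a bound or a sign
    known for [w] on the whole interval holds for all lower derivatives, [u]
    included ([ladder_descent]). If [w a > 0], then [w > 0] near [a] by
    continuity and hence [u > 0] near [a]. It remains to refute [w a <= 0].

    The second idea is that [w a <= 0] forces [w <= 0] near [a]
    ([top_le0], [top_deriv_near_le0]); then [u <= 0] near [a], which
    contradicts the positive values along the sequence. On a short interval [a, x], let [S] be the maximum of
    [|w|], attained at [y]. All the lower derivatives are bounded by [S], so
    the differential inequality gives [w' <= C S], and [w] can rise by at most
    [S / 2] on [a, x] once [C (x - a) <= 1 / 2]. Starting from [w a <= 0], the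
    value [w y = S] is out of reach unless [S = 0]; hence [w y = - S], and from
    there [w x <= - S + S / 2 <= 0]. *)

(** * Chains of derivatives with vanishing initial data *)

Section Ladder.
Context {R : realType}.
Variables (g : nat -> R -> R) (m : nat) (a x : R).
Hypothesis (ax1 : x - a <= 1).
Hypothesis gcont : forall k, (k <= m)%N -> {within `[a, x], continuous (g k)}.
Hypothesis gder : forall k y, (k <= m)%N -> a < y < x ->
  is_derive y 1 (g k) (g k.+1 y).
Hypothesis g_init : forall k, (k < m)%N -> g k a = 0.

Lemma ladder_MVT k p q : (k <= m)%N -> a <= p -> p < q -> q <= x ->
  exists2 z, p < z < q & g k q - g k p = g k.+1 z * (q - p).
Proof.
move=> km ap pq qx.
have [||z zI ->] := @MVT R (g k) (g k.+1) p q pq.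
- move=> z; rewrite in_itv /= => /andP[pz zq]; apply: gder => //.
  by rewrite (le_lt_trans ap pz) (lt_le_trans zq qx).
- apply: (@continuous_subspaceW _ _ _ _ _ _ (gcont _ km)) => z /=.
  by rewrite !in_itv /= => /andP[pz zq]; rewrite (le_trans ap) ?(le_trans zq).
- by exists z => //; move: zI; rewrite in_itv.
Qed.

(** Stability under scaling by factors in ]0, 1] is what the sign conditions
    and the bounds on the absolute value have in common, and it is all that
    the mean value theorem requires on an interval of length at most 1. *)
Lemma ladder_descent (P : R -> Prop) :
  (forall t v, 0 < t <= 1 -> P v -> P (v * t)) ->
  (forall y, a < y < x -> P (g m y)) ->
  forall k y, (k <= m)%N -> a < y < x -> P (g k y).
Proof.
move=> Pscale Pm k y km; rewrite -(subKn km).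
elim: (m - k)%N y => [|j IHj] y axy; first by rewrite subn0; exact: Pm.
have [mj|jm] := leqP m j.
  have -> : (m - j.+1 = m - j)%N by lia.
  exact: IHj.
have /andP[ay yx] := axy.
have jE : (m - j.+1).+1 = (m - j)%N by lia.
have [||||z /andP[az zy]] := @ladder_MVT (m - j.+1)%N a y; rewrite ?leq_subr ?(ltW yx) //.
rewrite jE g_init ?subr0 => [->|]; last lia.
apply: Pscale; last by apply: IHj; rewrite az (lt_trans zy).
by rewrite subr_gt0 ay /= (le_trans _ ax1)// lerD2r ltW.
Qed.

Variable M : R.
Hypothesis (ax : a < x) (M0 : 0 <= M).
Hypothesis Mx : M * m.+1%:R * (x - a) <= 2^-1.
Hypothesis gtop : forall y, a < y < x ->
  g m.+1 y <= M * \sum_(k < m.+1) `|g k y|.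

(** A barrier argument at a maximum point of [|g m|]. Only an upper bound on
    the derivative of [g m] is available, so [g m] can fall fast but not rise
    fast; this asymmetry is what selects the sign. *)
Lemma top_le0 : g m a <= 0 -> g m x <= 0.
Proof.
move=> ga.
have [|y] := @EVT_max R (fun z => `|g m z|) a x (ltW ax).
  by move=> z; apply: continuous_comp; [exact: gcont | exact: norm_continuous].
rewrite in_itv /= => /andP[ay yx]; set S := `|g m y| => Smax.
have Sle k z : (k <= m)%N -> a < z < x -> `|g k z| <= S.
  apply: (@ladder_descent (fun v => `|v| <= S)) => [t v /andP[t0 t1] vS|r /andP[ar rx]].
    by rewrite normrM (gtr0_norm t0) (le_trans _ vS)// ler_piMr.
  by apply: Smax; rewrite in_itv /= !ltW.
(* [S / 2] bounds the rise because the length of [a, x] is small against the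
   slope [M * m.+1 * S]. *)
have rise p q : a <= p -> p <= q -> q <= x -> g m q <= g m p + S / 2.
  have S0 : 0 <= S by exact: normr_ge0.
  move=> ap; rewrite le_eqVlt => /orP[/eqP -> _|pq qx]; first lra.
  have [z /andP[pz zq] gE] := @ladder_MVT m p q (leqnn m) ap pq qx.
  have axz : a < z < x by rewrite (le_lt_trans ap pz) (lt_le_trans zq qx).
  have gz : g m.+1 z <= M * m.+1%:R * S.
    apply: le_trans (gtop _ axz) _; rewrite -mulrA ler_wpM2l//.
    have -> : m.+1%:R * S = \sum_(k < m.+1) S.
      by rewrite sumr_const card_ord mulr_natl.
    by apply: ler_sum => k _; apply: Sle; rewrite // -ltnS.
  have h1 : g m.+1 z * (q - p) <= M * m.+1%:R * S * (q - p).
    by rewrite ler_wpM2r// subr_ge0 ltW.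
  have h2 : M * m.+1%:R * S * (q - p) <= M * m.+1%:R * S * (x - a).
    by apply: ler_wpM2l; [rewrite !mulr_ge0 | lra].
  have h3 : M * m.+1%:R * S * (x - a) <= 2^-1 * S.
    by rewrite mulrAC ler_wpM2r.
  lra.
have gxS : g m x <= S.
  by rewrite (le_trans (ler_norm _))// Smax// in_itv /= lexx ltW.
have ry := rise a y (lexx a) ay yx.
have rx := rise y x ay yx (lexx x).
(* If [0 <= g m y], the rise from [g m a] to [g m y = S] forces [S <= 0];
   otherwise the rise from [g m y = - S] leaves [g m x] at most [- S / 2]. *)
have [gy|gy] := leP 0 (g m y).
- by have SE : S = g m y by [exact: ger0_norm]; lra.
- by have SE : S = - g m y by [exact: ltr0_norm]; lra.
Qed.

End Ladder.

(** * Derivatives relative to a half-open interval *)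

Section Regularity.
Context {R : realType}.
Implicit Types (D : set R) (f u : R -> R) (x : R).

(** As in the unrestricted case: the increment is [h] times a convergent
    difference quotient. *)
Lemma derivable_on_cvg D f x :
  derivable_on D f x -> f y @[y --> within D (nbhs x)] --> f x.
Proof.
set F := within [set h | D (h + x)] 0^' => df.
have FF : Filter F by exact: within_filter.
have h0 : (h : R) @[h --> F] --> (0 : R).
  by move=> A A0; apply: cvg_within; exact: nbhs_dnbhs.
have : (h * (h^-1 * (f (h + x) - f x))) @[h --> F] --> (0 : R).
  by rewrite -(mul0r (derive1_on D f x)); apply: cvgM h0 df.
move=> /cvgrPdist_lt dq0.
apply/cvgrPdist_lt => e e0; rewrite near_withinE.
suff : \forall h \near (0 : R), D (h + x) -> `|f x - f (h + x)| < e.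
  have := near_shift 0 x (fun y => D y -> `|f x - f y| < e).
  by rewrite /= subr0 => <-.
have := dq0 e e0; rewrite !near_withinE; apply: filterS => h He Dh.
have [->|hN0] := eqVneq h 0.
  by rewrite add0r subrr normr0.
by have := He hN0 Dh; rewrite /= mulVKf// sub0r opprB.
Qed.

Lemma Ck_on_continuous D u m k : Ck_on D m u -> (k <= m)%N ->
  {within D, continuous (derive1n_on D k u)}.
Proof.
move=> [du cu]; rewrite leq_eqVlt => /orP[/eqP -> //|km].
by apply/subspace_continuousP => x Dx; exact/derivable_on_cvg/du.
Qed.

(** At interior points the derivatives relative to [D] and to [E] are both
    the ordinary ones, so differentiability can be imported from [E]. *)
Lemma is_derive_derive1n_on D E u n k x : Ck_on E n u -> (k < n)%N ->
  D° x -> E° x ->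
  is_derive x 1 (derive1n_on D k u) (derive1n_on D k.+1 u x).
Proof.
move=> [du _] kn Dx Ex.
have DE : \forall y \near x, derive1n_on E k u y = derive1n_on D k u y.
  have nbhsI (A : set R) : A° x -> nbhs x A°.
    by move=> Ax; apply: open_nbhs_nbhs; split => //; exact: open_interior.
  apply: filterS2 (nbhsI _ Dx) (nbhsI _ Ex) => y Dy Ey.
  by rewrite !derive1n_on_interior.
have dD : derivable (derive1n_on D k u) x 1.
  have Ek := du k kn x (interior_subset Ex).
  have dE := (derivable_on_interior (derive1n_on E k u) Ex).1 Ek.
  exact: (@near_eq_derivable _ _ _ _ _ _ _ DE dE).
have -> : derive1n_on D k.+1 u x = 'D_1 (derive1n_on D k u) x.
  rewrite -derive1E; exact: (@derive1n_on_interior R D 1 (derive1n_on D k u) x Dx).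
exact/derivableP.
Qed.

Lemma near_right_within (a b : R) (P : set R) : a < b ->
  (\forall x \near within `[a, b[ (nbhs a), P x) -> \forall x \near a^'+, P x.
Proof.
move=> ab; rewrite near_withinE => aP; have xb := nbhs_right_lt ab.
rewrite /at_right near_withinE in xb *.
apply: filterS2 aP xb => x xP xb ax; apply: xP.
by rewrite /= in_itv /= (ltW ax) xb.
Qed.

Lemma near_right_ex (a : R) (P : set R) : (\forall x \near a^'+, P x) ->
  exists2 d, a < d & forall x, a < x <= d -> P x.
Proof.
rewrite /at_right near_withinE => -[/= e e0 eP].
exists (a + e / 2); first by rewrite ltrDl divr_gt0.
move=> x /andP[ax xe]; apply: eP => //=.
by rewrite ltr0_norm ?subr_lt0//; lra.
Qed.

End Regularity.

(** * Sign of the solution near the endpoint *)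

Section Sign.
Context {R : realType}.
Variables (m : nat) (a b : R) (u : R -> R) (c : 'I_m.+1 -> R -> R).
Hypothesis ab : a < b.
Hypothesis hu_open : Ck_on `]a, b[ m.+1 u.
Hypothesis hu_closed : Ck_on `[a, b[ m u.
Hypothesis hineq : forall x, a < x < b ->
  derive1n m.+1 u x + \sum_(k < m.+1) c k x * derive1n k u x <= 0.
Hypothesis c_bnd : forall k, exists M, \forall x \near a^'+, `|c k x| <= M.
Hypothesis hua : forall k, (k < m)%N -> derive1n_on `[a, b[ k u a = 0.

Let g k := derive1n_on `[a, b[ k u.

Let axb_interior x : a < x < b -> `[a, b[%classic° x.
Proof. by rewrite interior_itv /= in_itv. Qed.

Let g_cont x k : x < b -> (k <= m)%N -> {within `[a, x], continuous (g k)}.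
Proof.
move=> xb km.
apply: (@continuous_subspaceW _ _ _ _ _ _ (Ck_on_continuous _ _ _ _ hu_closed km)).
by move=> z /=; rewrite !in_itv /= => /andP[-> /le_lt_trans ->].
Qed.

Let g_der x k y : x < b -> (k <= m)%N -> a < y < x ->
  is_derive y 1 (g k) (g k.+1 y).
Proof.
move=> xb km /andP[ay yx]; have axy : a < y < b by rewrite ay (lt_trans yx).
apply: (is_derive_derive1n_on _ _ _ _ _ _ hu_open) => //; first exact: axb_interior.
by rewrite interior_itv /= in_itv.
Qed.

Lemma coeff_uniform_bound :
  exists2 M, 0 <= M & \forall x \near a^'+, forall k, `|c k x| <= M.
Proof.
have [M cM] := choice c_bnd.
exists (\sum_k `|M k|); first exact: sumr_ge0.
have : \forall x \near a^'+, forall k, `|c k x| <= M k by exact: filter_forall.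
apply: filterS => x cMx k.
rewrite (le_trans (cMx k))// (le_trans (ler_norm _))// (bigD1 k)//= lerDl.
exact: sumr_ge0.
Qed.

Lemma top_deriv_near_le0 : g m a <= 0 -> \forall x \near a^'+, g m x <= 0.
Proof.
move=> ga; have [M M0 cM] := coeff_uniform_bound.
have [d ad dM] := near_right_ex _ _ cM.
set C := M * m.+1%:R; have C0 : 0 <= C by exact: mulr_ge0.
near=> x.
have ax : a < x by near: x; exact: nbhs_right_gt.
have xd : x < d by near: x; exact: nbhs_right_lt.
have xb : x < b by near: x; exact: nbhs_right_lt.
(* The [+ 1] keeps the bound meaningful for [C = 0], and makes [x - a <= 1]. *)
have xC : x < a + (C + 1)^-1 / 2.
  by near: x; apply: nbhs_right_lt; rewrite ltrDl divr_gt0// invr_gt0 ltr_wpDl.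
have C1 : (C + 1)^-1 <= 1 by rewrite invf_le1 ?ltr_wpDl// lerDr.
have CC : C * (C + 1)^-1 <= 1 by rewrite ler_pdivrMr ?ltr_wpDl// mul1r lerDl.
apply: (@top_le0 R g m a x _ _ _ _ M) => //.
- by lra.
- by move=> k; exact: g_cont.
- by move=> k y; exact: g_der.
- have h1 : C * (x - a) <= C * ((C + 1)^-1 / 2) by apply: ler_wpM2l => //; lra.
  by apply: le_trans h1 _; rewrite mulrA; lra.
move=> y /andP[ay yx]; have yab : a < y < b by rewrite ay (lt_trans yx).
have gE k : g k y = derive1n k u y.
  by rewrite /g derive1n_on_interior//; exact: axb_interior.
have := hineq y yab; rewrite -gE -lerBrDr sub0r => /le_trans; apply.
rewrite -sumrN mulr_sumr; apply: ler_sum => k _.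
rewrite -gE (le_trans (ler_norm _))// normrN normrM ler_wpM2r//.
by apply: dM; rewrite ay ltW// (lt_trans yx).
Unshelve. all: by end_near. Qed.

(** Used with [P v] being [v <= 0], to refute [g m a <= 0], and [0 < v], to
    obtain the positivity of [u]. *)
Lemma near_descent (P : R -> Prop) :
  (forall t v, 0 < t <= 1 -> P v -> P (v * t)) ->
  (\forall x \near a^'+, P (g m x)) -> \forall x \near a^'+, P (u x).
Proof.
move=> Pscale /near_right_ex[d ad dP].
(* The three bounds serve the validity of [P (g m)], the length at most 1 asked
   by [ladder_descent], and the inclusion in [a, b[. *)
have ad' : a < Num.min d (Num.min (a + 1) ((a + b) / 2)).
  by rewrite !lt_min ad (midf_lt ab) ltrDl ltr01.
set d' := Num.min _ _ in ad'.
near=> x.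
have axd : a < x < d'.
  apply/andP; split; first by near: x; exact: nbhs_right_gt.
  by near: x; exact: nbhs_right_lt.
have := lexx d'; rewrite {2}/d' !le_min => /and3P[d'd d'1 d'b].
have {}d'b : d' < b by rewrite (le_lt_trans d'b)// (midf_lt ab).
apply: (@ladder_descent R g m a d' _ _ _ _ P Pscale _ 0%N) => //.
- by lra.
- by move=> k; exact: g_cont.
- by move=> k y; exact: g_der.
- by move=> y /andP[ay yd]; apply: dP; rewrite ay (le_trans (ltW yd)).
Unshelve. all: by end_near. Qed.

Lemma sign_near_endpoint (x_ : nat -> R) : (forall i, a < x_ i < b) ->
  x_ @ \oo --> a -> (forall i, 0 < u (x_ i)) ->
  0 < derive1n_on `[a, b[ m u a /\
  exists2 delta : R, 0 < delta & forall x, a < x < a + delta -> 0 < u x.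
Proof.
move=> x_in x_cvg x_pos.
have wa : 0 < g m a.
  rewrite ltNge; apply/negP => /top_deriv_near_le0 w_le0.
  have /near_right_ex[d ad dP] : \forall x \near a^'+, u x <= 0.
    apply: (near_descent (fun v => v <= 0)) w_le0 => t v /andP[t0 _] v0.
    by rewrite mulr_le0_ge0// ltW.
  have [i _ /(_ i (leqnn i)) xd] := cvgr_lt _ x_cvg _ ad.
  have /andP[ax _] := x_in i.
  by have := dP (x_ i); rewrite ax (ltW xd) leNgt x_pos => /(_ isT).
split=> //.
have w_pos : \forall x \near a^'+, 0 < g m x.
  apply: (near_right_within _ _ _ ab).
  have /subspace_continuousP /(_ a) := hu_closed.2.
  rewrite /= in_itv /= lexx ab => /(_ isT) /cvgr_gt; exact.
have /near_right_ex[d ad dP] : \forall x \near a^'+, 0 < u x.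
  by apply: (near_descent (fun v => 0 < v)) w_pos => t v /andP[t0 _] v0;
    exact: mulr_gt0.
exists (d - a); rewrite ?subr_gt0// => x.
by rewrite addrC subrK => /andP[ax xd]; apply: dP; rewrite ax ltW.
Qed.

End Sign.

Theorem theorem1p2 (R : realType) (n : nat) (a b : R) (u : R -> R)
    (c : 'I_n -> R -> R) (x_ : nat -> R)
    (hn : (2 <= n)%N) (hab : a < b)
    (hu_open : Ck_on `]a, b[ n u) (hu_closed : Ck_on `[a, b[ n.-1 u)
    (hineq : forall x, a < x < b ->
       derive1n n u x + \sum_(k < n) c k x * derive1n k u x <= 0)
    (hua : forall k : nat, (k <= n - 2)%N -> derive1n_on `[a, b[ k u a = 0)
    (hx_in : forall i, a < x_ i < b)
    (hx_cvg : x_ @ \oo --> a)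
    (hx_pos : forall i, 0 < u (x_ i)) :
  let conclusion :=
    0 < derive1n_on `[a, b[ n.-1 u a /\
    exists2 delta : R, 0 < delta & forall x, a < x < a + delta -> 0 < u x in
  ((forall k, {within `[a, b[, continuous (c k)}) -> conclusion) /\
  (n = 2%N -> (forall k, [bounded c k x | x in `[a, b[]) -> conclusion).
Proof.
case: n hn c hu_open hu_closed hineq hua => // m m1 {}c uo uc ineq ua /=.
have {}ua k : (k < m)%N -> derive1n_on `[a, b[ k u a = 0.
  by move=> km; apply: ua; lia.
split=> [c_cont|_ c_bnd];
  apply: (sign_near_endpoint _ _ _ _ _ hab uo uc ineq _ ua _ hx_in hx_cvg hx_pos).
- move=> k; exists (`|c k a| + 1); apply: (near_right_within _ _ _ hab).
  have /subspace_continuousP /(_ a) := c_cont k.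
  rewrite /= in_itv /= lexx hab => /(_ isT) /cvgr_norm_le; apply.
  by rewrite ltrDl.
- move=> k; have [M _ cM] := pinfty_ex_gt0 (c_bnd k).
  exists M; apply: (near_right_within _ _ _ hab).
  by rewrite near_withinE; apply: nearW => x; exact: cM.
Qed.
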